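(* Let $M\ge 1$, let $D_\zeta$ be the unit disk with $M$ closed circular holes removed, let $\theta_{\pm1},\dots,\theta_{\pm M}$ be the associated basic Möbius transformations and $\Theta$ the Schottky group they generate, and let $\zeta,\alpha\in D_\zeta$ with $\zeta\ne\alpha$ (all notation as in the context). Let $j,k\in\{\pm1,\dots,\pm M\}$ with $k\ne -j$, and let $z_k^{\mathrm{fix}}\in\mathbb{C}\cup\{\infty\}$ be either of the two fixed points of $\theta_k$. For $w\in C_j$ and $x\in\{\zeta,\alpha\}$ put $$R_k(w;x):=R\big(w,\,z_k^{\mathrm{fix}},\,\theta_k^{-1}(x),\,x\big),$$ and define $$\Delta_{j,k}^{\mathrm{lb}}(\zeta,\alpha):=-\log|\theta_k'(z_k^{\mathrm{fix}})|+\min_{w\in C_j}\log|R_k(w;\zeta)|+\min_{w\in C_j}\log|R_k(w;\alpha)|,$$ $$\Delta_{j,k}^{\mathrm{ub}}(\zeta,\alpha):=-\log|\theta_k'(z_k^{\mathrm{fix}})|+\max_{w\in C_j}\log|R_k(w;\zeta)|+\max_{w\in C_j}\log|R_k(w;\alpha)|.$$ Then for every reduced word $\psi=\theta_{j_\ell}\cdots\theta_{j_1}\in\Theta\setminus\{\mathrm{Id}\}$ (with $\ell\ge1$) whose leftmost index is $j_\ell=j$, $$\Delta_{j,k}^{\mathrm{lb}}(\zeta,\alpha)\;\le\;U_{\zeta,\alpha}(\theta_k\psi)-U_{\zeta,\alpha}(\psi)\;\le\;\Delta_{j,k}^{\mathrm{ub}}(\zeta,\alpha).$$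
   Context: Domain. Fix $M\ge1$. Let $D_0=\{|z|<1\}$ and, for $m=1,\dots,M$, $D_m=\{z\in\mathbb{C}:|z-\delta_m|<q_m\}$ with $\delta_m\in\mathbb{C}$, $q_m>0$, and $C_m=\partial D_m$. Assume $\overline{D_i}\cap\overline{D_j}=\emptyset$ for $i\ne j$ and $\overline{D_i}\subset D_0$ for all $i$. Put $D_\zeta=D_0\setminus\bigcup_{m=1}^M\overline{D_m}$ (here $D_\zeta$ is just the name of the domain). Möbius maps. For $m=1,\dots,M$, $$\theta_m(z)=\delta_m+\frac{q_m^2 z}{1-\overline{\delta_m}z},\qquad \theta_{-m}=\theta_m^{-1},\qquad \theta_{-m}(z)=\frac{z-\delta_m}{q_m^2-|\delta_m|^2+\overline{\delta_m}z},$$ acting on the Riemann sphere $\mathbb{C}\cup\{\infty\}$, and $C_{-m}=\theta_{-m}(C_m)$ (a circle on the Riemann sphere). The center and radius of $C_{-m}$ are $\delta_{-m}=\delta_m/(|\delta_m|^2-q_m^2)$ and $q_{-m}=q_m/\big||\delta_m|^2-q_m^2\big|$. With these, the derivative of $\theta_k$ is $\theta_k'(z)=q_k^2/(1-\overline{\delta_k}z)^2$ for every $k\in\{\pm1,\dots,\pm M\}$. If $z_k^{\mathrm{fix}}=\infty$ (possible only when $\delta_{|k|}=0$), then $\theta_k'(z_k^{\mathrm{fix}})$ means the derivative at the fixed point computed in the local coordinate $1/z$. Schottky group. $\Theta$ is the free group generated by $\theta_1,\dots,\theta_M$ under composition. Every non-identity element is uniquely a reduced word $\theta_{j_\ell}\cdots\theta_{j_1}$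 with $\ell\ge1$, $j_i\in\{\pm1,\dots,\pm M\}$, $j_{i+1}\ne-j_i$; the product denotes composition, the rightmost factor acting first. Cross-ratio and potential. $R(a,b,c,d)=\dfrac{(c-a)(d-b)}{(c-b)(d-a)}$. For $\theta\in\Theta\setminus\{\mathrm{Id}\}$, $$R_{\zeta,\alpha}(\theta)=\frac{(\theta(\zeta)-\alpha)(\theta(\alpha)-\zeta)}{(\theta(\zeta)-\zeta)(\theta(\alpha)-\alpha)},\qquad U_{\zeta,\alpha}(\theta)=-\log|R_{\zeta,\alpha}(\theta)-1|.$$ All cross-ratio expressions are extended by continuity when one of the points is $\infty$. *)

(* Defs.v *)
From Stdlib Require Export Reals ZArith List Sorted.
From Coquelicot Require Export Coquelicot.
Open Scope R_scope.

(** * The Riemann sphere *)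

Inductive sphere : Type :=
| Pt (z : C)
| Infty.

Definition quot (n d : C) : sphere :=
  if Ceq_dec d 0 then Infty else Pt (n / d)%C.

(** z |-> (a z + b) / (c z + d) on the sphere (meaningful when ad - bc <> 0) *)
Definition mobius (a b c d : C) (p : sphere) : sphere :=
  match p with
  | Pt z => quot (a * z + b)%C (c * z + d)%C
  | Infty => quot a c
  end.

Definition sinv : sphere -> sphere := mobius 0 1 1 0.

(** The difference [p - r] in homogeneous coordinates: with p = [p1 : p2] and
    r = [r1 : r2] it is p1 r2 - r1 p2, where z = [z : 1] and oo = [1 : 0].
    In a cross-ratio each point occurs once in the numerator and once in the
    denominator, so using [sdiff] for the differences is the extension of the
    cross-ratio by continuity to points at infinity. *)
Definition sdiff (p r : sphere) : C :=
  match p, r with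
  | Pt z, Pt w => (z - w)%C
  | Infty, Pt _ => 1%C
  | Pt _, Infty => (- (1))%C
  | Infty, Infty => 0%C
  end.

Definition cross_ratio (a b c d : sphere) : C :=
  ((sdiff c a * sdiff d b) / (sdiff c b * sdiff d a))%C.

(** * The domain.  The data [delta m], [q m] matter only for 1 <= m <= M. *)

Definition in_closed_disk (delta : nat -> C) (q : nat -> R) (m : nat) (z : C) :
  Prop := Cmod (z - delta m) <= q m.

Definition circular_holes (M : nat) (delta : nat -> C) (q : nat -> R) : Prop :=
  (forall m, (1 <= m <= M)%nat -> 0 < q m) /\
  (forall i j, (1 <= i <= M)%nat -> (1 <= j <= M)%nat -> i <> j ->
     forall z, ~ (in_closed_disk delta q i z /\ in_closed_disk delta q j z)) /\
  (forall i, (1 <= i <= M)%nat ->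
     forall z, in_closed_disk delta q i z -> Cmod z < 1).

Definition in_domain (M : nat) (delta : nat -> C) (q : nat -> R) (z : C) : Prop :=
  Cmod z < 1 /\
  forall m, (1 <= m <= M)%nat -> ~ in_closed_disk delta q m z.

(** * Basic Möbius maps, circles and words.
    Indices in {±1, ..., ±M} are integers [k : Z] with 1 <= |k| <= M. *)

Definition is_index (M : nat) (k : Z) : Prop := (1 <= Z.abs k <= Z.of_nat M)%Z.

(** delta_m + q_m^2 z / (1 - conj(delta_m) z), over a common denominator *)
Definition theta_pos (delta : nat -> C) (q : nat -> R) (m : nat) :
  sphere -> sphere :=
  mobius (RtoC (q m ^ 2) - RtoC (Cmod (delta m) ^ 2))%C (delta m)
         (- Cconj (delta m))%C 1.

(** (z - delta_m) / (q_m^2 - |delta_m|^2 + conj(delta_m) z) *)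
Definition theta_neg (delta : nat -> C) (q : nat -> R) (m : nat) :
  sphere -> sphere :=
  mobius 1 (- delta m)%C
         (Cconj (delta m)) (RtoC (q m ^ 2) - RtoC (Cmod (delta m) ^ 2))%C.

Definition theta (delta : nat -> C) (q : nat -> R) (k : Z) : sphere -> sphere :=
  if (0 <? k)%Z then theta_pos delta q (Z.abs_nat k)
  else theta_neg delta q (Z.abs_nat k).

Definition on_circle_pos (delta : nat -> C) (q : nat -> R) (m : nat)
  (p : sphere) : Prop :=
  exists z : C, p = Pt z /\ Cmod (z - delta m) = q m.

(** C_{-m} is the image theta_{-m}(C_m); it passes through infinity when
    |delta_m| = q_m. *)
Definition on_circle (delta : nat -> C) (q : nat -> R) (k : Z) (p : sphere) :
  Prop :=
  if (0 <? k)%Z then on_circle_pos delta q (Z.abs_nat k) p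
  else exists r, on_circle_pos delta q (Z.abs_nat k) r /\ p = theta delta q k r.

(** The word theta_{j_l} ... theta_{j_1} is the list [j_l; ...; j_1]: the head
    is the leftmost letter, which acts last. *)
Definition reduced_word (M : nat) (w : list Z) : Prop :=
  List.Forall (is_index M) w /\ Sorted (fun a b : Z => a <> (- b)%Z) w.

Definition word_map (delta : nat -> C) (q : nat -> R) (w : list Z) :
  sphere -> sphere :=
  fold_right (fun k f p => theta delta q k (f p)) (fun p => p) w.

(** * The potential *)

Definition R_pot (zeta alpha : C) (f : sphere -> sphere) : C :=
  ((sdiff (f (Pt zeta)) (Pt alpha) * sdiff (f (Pt alpha)) (Pt zeta)) /
   (sdiff (f (Pt zeta)) (Pt zeta) * sdiff (f (Pt alpha)) (Pt alpha)))%C.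

Definition U_pot (zeta alpha : C) (f : sphere -> sphere) : R :=
  - ln (Cmod (R_pot zeta alpha f - 1)).

(** * The bounds *)

(** The value at [Infty] is irrelevant below: [coord] is only used near points
    where the maps take finite values. *)
Definition coord (p : sphere) : C :=
  match p with Pt z => z | Infty => 0%C end.

(** [lam] is the complex derivative of [f] at its fixed point [p], computed in
    the coordinate z if [p] is finite and in the coordinate 1/z if [p] = oo. *)
Definition is_derivative_at_fixpoint (f : sphere -> sphere) (p : sphere)
  (lam : C) : Prop :=
  match p with
  | Pt z =>
      @is_derive C_AbsRing C_NormedModule (fun u : C => coord (f (Pt u))) z lam
  | Infty =>
      @is_derive C_AbsRing C_NormedModule
        (fun u : C => coord (sinv (f (sinv (Pt u))))) (RtoC 0) lam
  end.

Definition is_min (S : sphere -> Prop) (f : sphere -> R) (m : R) : Prop :=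
  (exists w, S w /\ f w = m) /\ forall w, S w -> m <= f w.

Definition is_max (S : sphere -> Prop) (f : sphere -> R) (m : R) : Prop :=
  (exists w, S w /\ f w = m) /\ forall w, S w -> f w <= m.

Definition R_k (delta : nat -> C) (q : nat -> R) (k : Z) (zfix : sphere)
  (w : sphere) (x : C) : C :=
  cross_ratio w zfix (theta delta q (- k) (Pt x)) (Pt x).

(** Derivatives, minima and maxima are unique when they exist, so the next two
    predicates determine [d]. *)
Definition is_Delta_lb (delta : nat -> C) (q : nat -> R) (zeta alpha : C)
  (j k : Z) (zfix : sphere) (d : R) : Prop :=
  exists (lam : C) (m1 m2 : R),
    is_derivative_at_fixpoint (theta delta q k) zfix lam /\
    is_min (on_circle delta q j)
      (fun w => ln (Cmod (R_k delta q k zfix w zeta))) m1 /\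
    is_min (on_circle delta q j)
      (fun w => ln (Cmod (R_k delta q k zfix w alpha))) m2 /\
    d = - ln (Cmod lam) + m1 + m2.

Definition is_Delta_ub (delta : nat -> C) (q : nat -> R) (zeta alpha : C)
  (j k : Z) (zfix : sphere) (d : R) : Prop :=
  exists (lam : C) (m1 m2 : R),
    is_derivative_at_fixpoint (theta delta q k) zfix lam /\
    is_max (on_circle delta q j)
      (fun w => ln (Cmod (R_k delta q k zfix w zeta))) m1 /\
    is_max (on_circle delta q j)
      (fun w => ln (Cmod (R_k delta q k zfix w alpha))) m2 /\
    d = - ln (Cmod lam) + m1 + m2.

(* Main.v *)
Require Import Defs.
From Stdlib Require Import Lra Lia Psatz.

(** Write T for [theta k], z for its fixed point, and A, B for the images of
    zeta, alpha under psi.  The bounds come from an exact formula: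

      U(T psi) - U(psi) = - log|T'(z)| + log|R_k(A; zeta)| + log|R_k(B; alpha)|.

    To see it, note first that the three-term identity among cross-ratios gives
      R(f) - 1 = (f(zeta) - f(alpha)) (alpha - zeta)
                 / ((f(zeta) - zeta) (f(alpha) - alpha)),
    so each potential is a sum of logarithms of distances ([U_pot_expand]).  A
    Möbius map multiplies the distance of p and r by nu(p) nu(r) det, where nu
    depends on one point only ([sdiff_mobius]).  Applying this to the pairs
    (T^{-1} x, z) and (w, T^{-1} x) turns R_k(w; x) into
    (nu(z) / nu(w)) (T w - x) / (w - x); and T'(z) = nu(z)^2 det
    ([mobius_fixpoint_derivative]).  In the formula all factors nu(A), nu(B),
    nu(z), det cancel ([U_pot_increment]).  Homogeneous coordinates
    make these identities uniform on the sphere, infinity included.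

    It remains to compare the values of |R_k(.; x)| at A and B with its values
    on C_j.  Each index k has a disk D_k on the sphere with boundary C_k (for
    k = -m it is the mirror image of D_m in the unit circle), the closures of
    the 2M disks are disjoint, the domain lies outside all of them, and
    [theta k] maps the exterior of D_{-k} into D_k ([side_theta]).  Hence a
    reduced word with leftmost letter j maps the domain into D_j
    ([word_side]).  As a function of w, R_k(w; x) is a Möbius map whose zero
    T^{-1} x lies in D_{-k} and whose pole x lies in the domain; both are off
    the closure of D_j because k <> -j.  So the maximum principle, applied to
    this function and to its inverse, places its modulus at A and B between the
    minimum and the maximum over C_j ([R_k_extrema]).  For Möbius maps this
    principle is elementary: the image of the unit disk is a disk with explicit
    centre and radius, which also yields the extremal points
    ([mobius_disk_max]). *)

(** * Homogeneous coordinates and Möbius maps *)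

Definition hX (p : sphere) : C := match p with Pt z => z | Infty => 1%C end.
Definition hY (p : sphere) : C := match p with Pt _ => 1%C | Infty => 0%C end.

Lemma C1_neq_0 : (RtoC 1) <> 0%C.
Proof. intros H; apply (f_equal Re) in H; simpl in H; lra. Qed.

Lemma sdiff_lift p r : sdiff p r = (hX p * hY r - hX r * hY p)%C.
Proof. destruct p, r; simpl; ring. Qed.

Lemma sdiff_eq0 p r : sdiff p r = 0%C -> p = r.
Proof.
  destruct p as [z|], r as [w|]; simpl; intros H; auto.
  - f_equal. replace z with ((z - w) + w)%C by ring. rewrite H; ring.
  - exfalso; apply C1_neq_0. replace (RtoC 1) with (- - (1))%C by ring. rewrite H; ring.
  - exfalso; apply C1_neq_0; auto.
Qed.

Lemma lift_neq_0 p : ~ (hX p = 0%C /\ hY p = 0%C).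
Proof. destruct p; simpl; intros [H1 H2]; apply C1_neq_0; auto. Qed.

(** The factor by which a homogeneous pair exceeds the normalized lift of the
    point that it represents: pairs with d <> 0 are normalized to [n/d : 1] and
    the others to [1 : 0]. *)
Definition scale (n d : C) : C := if Ceq_dec d 0 then n else d.

Lemma quot_lift (n d : C) : ~ (n = 0%C /\ d = 0%C) ->
  scale n d <> 0%C /\
  n = (scale n d * hX (quot n d))%C /\ d = (scale n d * hY (quot n d))%C.
Proof.
  intros H; unfold quot, scale; destruct (Ceq_dec d 0) as [E|E]; simpl.
  - repeat split; [intros F; apply H; auto | ring | rewrite E; ring].
  - repeat split; auto; [field; auto | ring].
Qed.

(** The value [nu p] is the scalar lost when the image of the lift of [p] under
    the matrix is normalized again; for finite points with finite images it is
    1 / (c z + d), a square root of T'(z) / det. *)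
Definition multiplier (a b c d : C) (nu : sphere -> C) : Prop :=
  forall p, nu p <> 0%C /\
    hX (mobius a b c d p) = (nu p * (a * hX p + b * hY p))%C /\
    hY (mobius a b c d p) = (nu p * (c * hX p + d * hY p))%C.

Lemma mobius_coords (a b c d : C) : (a * d - b * c <> 0)%C ->
  exists nu : sphere -> C, multiplier a b c d nu.
Proof.
  intros Hdet.
  exists (fun p => / scale (a * hX p + b * hY p) (c * hX p + d * hY p))%C; intros p.
  assert (E : mobius a b c d p = quot (a * hX p + b * hY p) (c * hX p + d * hY p)).
  { destruct p; simpl; f_equal; ring. }
  rewrite E.
  destruct (quot_lift (a * hX p + b * hY p) (c * hX p + d * hY p)) as (Hs & E1 & E2).
  - intros [H1 H2]; apply (lift_neq_0 p); split.
    + destruct (Ceq_dec (hX p) 0) as [F|F]; auto; exfalso; apply Hdet.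
      replace (a * d - b * c)%C with
        ((d * (a * hX p + b * hY p) - b * (c * hX p + d * hY p)) / hX p)%C
        by (field; auto).
      rewrite H1, H2; field; auto.
    + destruct (Ceq_dec (hY p) 0) as [F|F]; auto; exfalso; apply Hdet.
      replace (a * d - b * c)%C with
        ((a * (c * hX p + d * hY p) - c * (a * hX p + b * hY p)) / hY p)%C
        by (field; auto).
      rewrite H1, H2; field; auto.
  - set (s := scale _ _) in *; set (r := quot _ _) in *.
    rewrite E1, E2; repeat split; [|field; auto | field; auto].
    intros F. apply C1_neq_0. rewrite <- (Cinv_r s Hs), F; ring.
Qed.

(** The homogeneous form of |T p - T r|^2 = |T'(p)| |T'(r)| |p - r|^2. *)
Lemma sdiff_mobius (a b c d : C) (nu : sphere -> C) p r :
  multiplier a b c d nu ->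
  sdiff (mobius a b c d p) (mobius a b c d r)
  = (nu p * nu r * (a * d - b * c) * sdiff p r)%C.
Proof.
  intros H; destruct (H p) as (_ & P1 & P2); destruct (H r) as (_ & R1 & R2).
  rewrite !sdiff_lift, P1, P2, R1, R2; ring.
Qed.

(** On lifts a Möbius map is linear, so an equation between sphere points is
    the vanishing of a 2x2 determinant; identities between compositions of
    Möbius maps then follow by ring computations, without a case split at
    infinity. *)
Lemma mobius_char (a b c d : C) p r : (a * d - b * c <> 0)%C ->
  ((a * hX p + b * hY p) * hY r = hX r * (c * hX p + d * hY p))%C ->
  mobius a b c d p = r.
Proof.
  intros Hdet H.
  destruct (mobius_coords a b c d Hdet) as (nu & Hnu).
  destruct (Hnu p) as (_ & E1 & E2).
  apply sdiff_eq0. rewrite sdiff_lift, E1, E2.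
  transitivity (nu p * ((a * hX p + b * hY p) * hY r - hX r * (c * hX p + d * hY p)))%C; [ring|].
  rewrite H; ring.
Qed.

Lemma mobius_adjugate (a b c d : C) p : (a * d - b * c <> 0)%C ->
  mobius a b c d (mobius d (- b) (- c) a p) = p.
Proof.
  intros Hdet.
  assert (Hdet' : (d * a - (- b) * (- c) <> 0)%C).
  { replace (d * a - (- b) * (- c))%C with (a * d - b * c)%C by ring; auto. }
  destruct (mobius_coords d (- b) (- c) a Hdet') as (nu & Hnu).
  destruct (Hnu p) as (_ & E1 & E2).
  apply mobius_char; auto. rewrite E1, E2; ring.
Qed.

(** The error of the linear approximation is exactly
    - det c (u - z)^2 / ((c u + d) (c z + d)^2), which is quadratic in u - z as
    soon as |c u + d| stays above |c z + d| / 2. *)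
Lemma is_derive_mobius (a b c d z : C) : (c * z + d <> 0)%C ->
  @is_derive C_AbsRing C_NormedModule
    (fun u : C => ((a * u + b) / (c * u + d))%C) z
    ((a * d - b * c) / ((c * z + d) * (c * z + d)))%C.
Proof.
  intros Hz; split.
  { apply is_linear_scal_l. }
  intros y Hy. apply (is_filter_lim_locally_unique
    (K := C_AbsRing) (V := AbsRing_NormedModule C_AbsRing)) in Hy.
  rewrite <- Hy. clear y Hy.
  intros eps.
  set (det := (a * d - b * c)%C). set (v := (c * z + d)%C) in *.
  assert (Hv : 0 < Cmod v) by (apply Cmod_gt_0; auto).
  set (K := 2 * Cmod (det * c) / Cmod v ^ 3).
  assert (HK : 0 <= K).
  { unfold K; apply Rmult_le_pos; [pose proof (Cmod_ge_0 (det*c)); lra|].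
    left; apply Rinv_0_lt_compat, pow_lt; auto. }
  (* The first bound makes K |u - z| smaller than eps, with K + 1 avoiding a
     division by zero; the second keeps |c u + d| above |c z + d| / 2. *)
  set (e := Rmin (eps / (K + 1)) (Cmod v / (2 * (Cmod c + 1)))).
  pose proof (Cmod_ge_0 c) as Hc.
  assert (He : 0 < e).
  { apply Rmin_pos; apply Rdiv_lt_0_compat; try lra. apply cond_pos. }
  apply (locally_le_locally_norm (K := C_AbsRing) (V := AbsRing_NormedModule C_AbsRing) z).
  exists (mkposreal e He). intros u Hu.
  change (Cmod (u - z)%C < e) in Hu.
  change (Cmod (((a * u + b) / (c * u + d)) - ((a * z + b) / (c * z + d)) -
    (u - z) * (det / (v * v)))%C <= eps * Cmod (u - z)%C).
  assert (Hu1 : Cmod (u - z) < eps / (K + 1)) by (eapply Rlt_le_trans; [apply Hu|apply Rmin_l]).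
  assert (Hu2 : Cmod (u - z) < Cmod v / (2 * (Cmod c + 1)))
      by (eapply Rlt_le_trans; [apply Hu|apply Rmin_r]).
  assert (Hcu : Cmod v / 2 <= Cmod (c * u + d)).
  { assert (Cmod v <= Cmod (c * u + d) + Cmod (c * (z - u))).
    { eapply Rle_trans; [|apply Cmod_triangle]. right; f_equal; unfold v; ring. }
    rewrite Cmod_mult in H.
    replace (Cmod (z - u)) with (Cmod (u - z)) in H by (rewrite <- Cmod_opp; f_equal; ring).
    assert (Cmod c * Cmod (u - z) <= Cmod v / 2).
    { apply (Rmult_lt_compat_r (2 * (Cmod c + 1))) in Hu2; [|lra].
      replace (Cmod v / (2 * (Cmod c + 1)) * (2 * (Cmod c + 1))) with (Cmod v) in Hu2
          by (field; lra).
      pose proof (Cmod_ge_0 (u - z)). nra. }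
    lra. }
  assert (Hcu0 : (c * u + d <> 0)%C) by (apply Cmod_gt_0; lra).
  replace (((a * u + b) / (c * u + d)) - ((a * z + b) / (c * z + d)) -
    (u - z) * (det / (v * v)))%C with
    (- (det * c) / ((c * u + d) * (v * v)) * (u - z) * (u - z))%C
    by (unfold det, v; field; auto).
  rewrite !Cmod_mult, Cmod_div, Cmod_opp, !Cmod_mult
    by (repeat apply Cmult_neq_0; auto).
  pose proof (Cmod_ge_0 (u - z)) as Hd0.
  apply Rmult_le_compat_r; auto.
  apply Rle_trans with (K * Cmod (u - z)).
  - apply Rmult_le_compat_r; auto. unfold K. rewrite Cmod_mult.
    replace (2 * (Cmod det * Cmod c) / Cmod v ^ 3) with
      (Cmod det * Cmod c / (Cmod v / 2 * (Cmod v * Cmod v))) by (field; lra).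
    apply Rmult_le_compat_l; [apply Rmult_le_pos; apply Cmod_ge_0|].
    assert (0 < Cmod v * Cmod v) by (apply Rmult_lt_0_compat; auto).
    apply Rinv_le_contravar; [apply Rmult_lt_0_compat; lra|].
    apply Rmult_le_compat_r; lra.
  - apply (Rmult_lt_compat_r (K + 1)) in Hu1; [|lra].
    replace (eps / (K + 1) * (K + 1)) with (pos eps) in Hu1 by (field; lra). nra.
Qed.

(** When [d] vanishes both sides are 0, since / 0 = 0. *)
Lemma coord_quot (n d : C) : coord (quot n d) = (n / d)%C.
Proof.
  unfold quot; destruct (Ceq_dec d 0) as [E|E]; simpl; auto.
  rewrite E. apply injective_projections; simpl;
      unfold Rdiv; rewrite !Rmult_0_l, Rplus_0_l, Rinv_0; ring.
Qed.

(** A fixed point is an eigenline of the matrix, with eigenvalue 1 / nu.  The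
    derivative is the quotient of the other eigenvalue, nu det, by this one,
    whichever chart is used. *)
Lemma mobius_fixpoint_derivative (a b c d : C) p (nu : C) : (a * d - b * c <> 0)%C ->
  nu <> 0%C ->
  hX p = (nu * (a * hX p + b * hY p))%C -> hY p = (nu * (c * hX p + d * hY p))%C ->
  is_derivative_at_fixpoint (mobius a b c d) p (nu * nu * (a * d - b * c))%C.
Proof.
  intros Hdet Hnu E1 E2. destruct p as [z|]; simpl in *.
  - assert (Hd : (c * z + d <> 0)%C).
    { intros F; apply C1_neq_0. rewrite E2, Cmult_1_r, F; ring. }
    assert (En : (nu = / (c * z + d))%C).
    { rewrite <- (Cmult_1_r (/ _)), E2. field; auto. }
    replace (nu * nu * (a * d - b * c))%C with
      ((a * d - b * c) / ((c * z + d) * (c * z + d)))%C by (rewrite En; field; auto).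
    apply (is_derive_ext (K := C_AbsRing) (V := C_NormedModule)
      (fun u : C => ((a * u + b) / (c * u + d))%C)).
    + intros u; simpl. rewrite coord_quot; auto.
    + apply is_derive_mobius; auto.
  - assert (Ea : RtoC 1 = (nu * a)%C) by (rewrite E1 at 1; ring).
    assert (Ha : a <> 0%C).
    { intros F; apply C1_neq_0. rewrite Ea, F; ring. }
    assert (En : (nu = / a)%C) by (rewrite <- (Cmult_1_r (/ a)), Ea; field; auto).
    replace (nu * nu * (a * d - b * c))%C with
      ((d * a - c * b) / ((b * 0 + a) * (b * 0 + a)))%C
      by (rewrite En; field; auto).
    assert (Hdet' : (d * a - c * b <> 0)%C).
    { replace (d * a - c * b)%C with (a * d - b * c)%C by ring; auto. }
    assert (D1 : (0 * 0 - 1 * 1 <> 0)%C).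
    { intros F; apply C1_neq_0. transitivity (- (0 * 0 - 1 * 1))%C; [ring|rewrite F; ring]. }
    apply (is_derive_ext (K := C_AbsRing) (V := C_NormedModule)
      (fun u : C => ((d * u + c) / (b * u + a))%C)); [|apply is_derive_mobius].
    + intros u. rewrite <- (coord_quot (d * u + c) (b * u + a)). f_equal.
      change (quot (d * u + c) (b * u + a)) with (mobius d c b a (Pt u)).
      symmetry; unfold sinv; apply mobius_char; auto.
      change (quot (0 * u + 1) (1 * u + 0)) with (mobius 0 1 1 0 (Pt u)).
      destruct (mobius_coords a b c d Hdet) as (n1 & N1).
      destruct (mobius_coords 0 1 1 0 D1) as (n2 & N2).
      destruct (mobius_coords d c b a Hdet') as (n3 & N3).
      destruct (N1 (mobius 0 1 1 0 (Pt u))) as (_ & -> & ->).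
      destruct (N2 (Pt u)) as (_ & -> & ->).
      destruct (N3 (Pt u)) as (_ & -> & ->).
      simpl; ring.
    + intros F; apply Ha; rewrite <- F; ring.
Qed.

(** * The maximum principle for Möbius maps on the unit disk *)

Lemma RtoC_neq_0 (x : R) : x <> 0 -> RtoC x <> 0%C.
Proof. intros H E; apply H; apply (f_equal Re) in E; exact E. Qed.

Lemma Cmod_align (a b : C) : exists s, Cmod s = 1 /\ Cmod (a + b * s) = Cmod a + Cmod b.
Proof.
  destruct (Ceq_dec a 0) as [Ea|Ea].
  { exists 1%C; split; [apply Cmod_1|]. rewrite Ea, Cmod_0, Rplus_0_l; f_equal; ring. }
  destruct (Ceq_dec b 0) as [Eb|Eb].
  { exists 1%C; split; [apply Cmod_1|]. rewrite Eb, Cmod_0, Rplus_0_r; f_equal; ring. }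
  pose proof (proj1 (Cmod_gt_0 a) Ea); pose proof (proj1 (Cmod_gt_0 b) Eb).
  assert (Ha : RtoC (Cmod a) <> 0%C) by (apply RtoC_neq_0; lra).
  exists ((a * Cmod b) / (Cmod a * b))%C; split.
  - rewrite Cmod_div, !Cmod_mult, !Cmod_R, !Rabs_pos_eq by (try apply Cmult_neq_0; auto; lra).
    field; lra.
  - replace (a + b * (a * Cmod b / (Cmod a * b)))%C with (a * RtoC ((Cmod a + Cmod b) / Cmod a))%C.
    + rewrite Cmod_mult, Cmod_R, Rabs_pos_eq; [field; lra|].
      apply Rmult_le_pos; [lra|left; apply Rinv_0_lt_compat; auto].
    + rewrite RtoC_div, RtoC_plus by lra. field; auto.
Qed.

(** For |c| < |d| this says that u |-> (conj d u + conj c) / (c u + d) maps the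
    unit disk, the unit circle and the exterior each into itself. *)
Lemma Cmod_reflect_identity (c d u : C) :
  Cmod (c * u + d) ^ 2 - Cmod (Cconj d * u + Cconj c) ^ 2
  = (Cmod d ^ 2 - Cmod c ^ 2) * (1 - Cmod u ^ 2).
Proof.
  rewrite !Cmod2_alt. destruct c, d, u; simpl; ring.
Qed.

Lemma Cmod_le_sq (x y : C) : Cmod x ^ 2 <= Cmod y ^ 2 -> Cmod x <= Cmod y.
Proof. intros H. pose proof (Cmod_ge_0 x); pose proof (Cmod_ge_0 y). nra. Qed.

Lemma Cmod_sq_conj (c : C) : RtoC (Cmod c ^ 2) = (c * Cconj c)%C.
Proof. rewrite Cmod2_alt; destruct c; apply injective_projections; simpl; ring. Qed.

(** With N = |d|^2 - |c|^2, h = b conj d - a conj c and e = a d - b c,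
      (a u + b) / (c u + d)
        = h / N + (e / N) (conj d u + conj c) / (c u + d),
    and the last factor maps the closed unit disk into itself and the circle
    onto itself.  So the image is the disk of centre h / N and radius |e| / N,
    and its farthest point from 0, at distance (|h| + |e|) / N, is the image of
    a point of the circle. *)
Lemma mobius_disk_max (a b c d : C) : Cmod c < Cmod d ->
  exists u0, Cmod u0 = 1 /\ forall u, Cmod u <= 1 ->
    Cmod (a * u + b) / Cmod (c * u + d) <= Cmod (a * u0 + b) / Cmod (c * u0 + d).
Proof.
  intros Hcd. pose proof (Cmod_ge_0 c) as Hc0.
  set (N := Cmod d ^ 2 - Cmod c ^ 2).
  assert (HN : 0 < N) by (unfold N; nra).
  assert (EN : RtoC N = (d * Cconj d - c * Cconj c)%C).
  { unfold N; rewrite RtoC_minus, !Cmod_sq_conj; auto. }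
  assert (Hden : forall u, Cmod u <= 1 -> 0 < Cmod (c * u + d)).
  { intros u Hu.
    assert (Cmod d <= Cmod (c * u + d) + Cmod (c * u)).
    { rewrite <- (Cmod_opp (c * u)). eapply Rle_trans;
        [|apply Cmod_triangle]. right; f_equal; ring. }
    rewrite Cmod_mult in H. pose proof (Cmod_ge_0 u). nra. }
  set (h := (b * Cconj d - a * Cconj c)%C). set (e := (a * d - b * c)%C).
  assert (Hdec : forall u, (RtoC N * (a * u + b) =
      h * (c * u + d) + e * (Cconj d * u + Cconj c))%C).
  { intros u; rewrite EN; unfold h, e; ring. }
  destruct (Cmod_align h e) as (s & Hs1 & Hs2).
  assert (Hw : (Cconj d - s * c <> 0)%C).
  { intros F. assert (E : Cmod (s * c) = Cmod d).
    { rewrite <- (Cmod_conj d). f_equal. transitivity (Cconj d - (Cconj d - s * c))%C;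
        [ring|rewrite F; ring]. }
    rewrite Cmod_mult, Hs1 in E; lra. }
  (* The solution of (conj d u + conj c) / (c u + d) = s. *)
  set (u0 := ((s * d - Cconj c) / (Cconj d - s * c))%C).
  assert (Hu0 : Cmod u0 = 1).
  { unfold u0; rewrite Cmod_div by auto.
    replace (Cmod (s * d - Cconj c)) with (Cmod (Cconj d - s * c)).
    - field. apply Rgt_not_eq, Cmod_gt_0; auto.
    - rewrite <- (Cmod_conj (s * d - Cconj c)), <- (Rmult_1_l (Cmod (Cconj _))),
        <- Hs1, <- Cmod_mult.
      f_equal. rewrite Cminus_conj, Cmult_conj, Cconj_conj.
      replace (s * (Cconj s * Cconj d - c))%C with ((s * Cconj s) * Cconj d - s * c)%C by ring.
      rewrite <- Cmod_sq_conj, Hs1. replace (RtoC (1 ^ 2)) with (RtoC 1) by (f_equal; ring). ring. }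
  exists u0; split; auto. intros u Hu.
  assert (Hval : Cmod (a * u0 + b) / Cmod (c * u0 + d) = (Cmod h + Cmod e) / N).
  { pose proof (Hden u0 (Req_le _ _ Hu0)) as Hd0.
    assert (E : (Cconj d * u0 + Cconj c = s * (c * u0 + d))%C).
    { unfold u0. field; auto. }
    pose proof (Hdec u0) as E0. rewrite E in E0.
    replace (h * (c * u0 + d) + e * (s * (c * u0 + d)))%C
        with ((h + e * s) * (c * u0 + d))%C in E0 by ring.
    apply (f_equal Cmod) in E0. rewrite !Cmod_mult, Hs2, Cmod_R, Rabs_pos_eq in E0 by lra.
    apply (Rmult_eq_reg_r (N * Cmod (c * u0 + d))); [|nra].
    field_simplify; lra. }
  rewrite Hval. pose proof (Hden u Hu) as Hd.
  assert (Cmod (Cconj d * u + Cconj c) <= Cmod (c * u + d)).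
  { apply Cmod_le_sq. pose proof (Cmod_reflect_identity c d u). fold N in H.
    pose proof (Cmod_ge_0 u). assert (0 <= 1 - Cmod u ^ 2) by nra. nra. }
  pose proof (f_equal Cmod (Hdec u)) as E. rewrite Cmod_mult, Cmod_R, Rabs_pos_eq in E by lra.
  pose proof (Cmod_triangle (h * (c * u + d)) (e * (Cconj d * u + Cconj c))) as T.
  rewrite !Cmod_mult in T. pose proof (Cmod_ge_0 e).
  apply (Rmult_le_reg_r (N * Cmod (c * u + d))); [nra|].
  replace (Cmod (a * u + b) / Cmod (c * u + d) * (N * Cmod (c * u + d)))
      with (N * Cmod (a * u + b)) by (field; lra).
  replace ((Cmod h + Cmod e) / N * (N * Cmod (c * u + d)))
      with ((Cmod h + Cmod e) * Cmod (c * u + d)) by (field; lra).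
  nra.
Qed.

Lemma nonvanishing_on_disk (c d : C) :
  (forall u, Cmod u <= 1 -> (c * u + d <> 0)%C) -> Cmod c < Cmod d.
Proof.
  intros H. destruct (Rlt_le_dec (Cmod c) (Cmod d)) as [L|L]; auto. exfalso.
  destruct (Ceq_dec c 0) as [E|E].
  - apply (H 0%C); [rewrite Cmod_0; lra|].
    assert (d = 0%C) as ->; [|ring].
    apply Cmod_eq_0. rewrite E, Cmod_0 in L. pose proof (Cmod_ge_0 d); lra.
  - apply (H (- d / c)%C); [|field; auto].
    rewrite Cmod_div, Cmod_opp by auto. pose proof (proj1 (Cmod_gt_0 c) E).
    apply (Rmult_le_reg_r (Cmod c)); auto. unfold Rdiv; rewrite Rmult_assoc, Rinv_l; lra.
Qed.

(** * The disks bounded by the circles *)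

(** The Hermitian form, in homogeneous coordinates, that is negative inside the
    disk of centre [delta] and radius [r] and positive outside. *)
Definition disk_form (delta : C) (r : R) (x y : C) : R :=
  Cmod (x - delta * y) ^ 2 - r ^ 2 * Cmod y ^ 2.

(** For k = -m the form of D_m is evaluated at the mirror image 1 / conj p of
    [p], whose lift is (conj y, conj x): C_{-m} is the mirror image of C_m in
    the unit circle.  So C_{-m} needs no centre or radius, and may be a line. *)
Definition side (delta : nat -> C) (q : nat -> R) (k : Z) (p : sphere) : R :=
  let m := Z.abs_nat k in
  if (0 <? k)%Z then disk_form (delta m) (q m) (hX p) (hY p)
  else disk_form (delta m) (q m) (Cconj (hY p)) (Cconj (hX p)).

Lemma Cconj_neq_0 (z : C) : z <> 0%C -> Cconj z <> 0%C.
Proof.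
  intros H E; apply H. apply Cmod_eq_0. rewrite <- Cmod_conj, E; apply Cmod_0.
Qed.

Lemma disk_form_scale delta r (l x y : C) :
  disk_form delta r (l * x) (l * y) = Cmod l ^ 2 * disk_form delta r x y.
Proof.
  unfold disk_form.
  replace (l * x - delta * (l * y))%C with (l * (x - delta * y))%C by ring.
  rewrite !Cmod_mult; ring.
Qed.

Lemma side_pos delta q k p : (0 < k)%Z ->
  side delta q k p
  = disk_form (delta (Z.abs_nat k)) (q (Z.abs_nat k)) (hX p) (hY p).
Proof. intros H; unfold side; destruct (Z.ltb_spec 0 k); [auto | lia]. Qed.

Lemma side_neg delta q k p : (k < 0)%Z ->
  side delta q k p = disk_form (delta (Z.abs_nat k)) (q (Z.abs_nat k))
    (Cconj (hY p)) (Cconj (hX p)).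
Proof. intros H; unfold side; destruct (Z.ltb_spec 0 k); [lia | auto]. Qed.

Lemma index_cases M k : is_index M k ->
  ((0 < k)%Z \/ (k < 0)%Z) /\ (1 <= Z.abs_nat k <= M)%nat.
Proof. unfold is_index; lia. Qed.

Lemma index_opp M k : is_index M k -> is_index M (- k).
Proof. unfold is_index; lia. Qed.

Lemma theta_mobius M delta q k : circular_holes M delta q -> is_index M k ->
  exists a b c d : C, theta delta q k = mobius a b c d /\ (a * d - b * c <> 0)%C.
Proof.
  intros (Hq & _) Hk. destruct (index_cases M k Hk) as (_ & Hm).
  assert (Hq2 : RtoC (q (Z.abs_nat k) ^ 2) <> 0%C).
  { apply RtoC_neq_0, Rgt_not_eq, pow_lt; auto. }
  unfold theta, theta_pos, theta_neg; destruct (0 <? k)%Z;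
    (eexists _, _, _, _; split; [reflexivity|]); rewrite (Cmod_sq_conj (delta _));
    intros F; apply Hq2; rewrite <- F; ring.
Qed.

Lemma theta_cancel M delta q k p : circular_holes M delta q -> is_index M k ->
  theta delta q k (theta delta q (- k) p) = p.
Proof.
  intros (Hq & _) Hk. destruct (index_cases M k Hk) as (_ & Hm).
  assert (Hq2 : RtoC (q (Z.abs_nat k) ^ 2) <> 0%C).
  { apply RtoC_neq_0, Rgt_not_eq, pow_lt; auto. }
  unfold theta. replace (Z.abs_nat (- k)) with (Z.abs_nat k) by lia.
  unfold theta_pos, theta_neg.
  set (m := Z.abs_nat k) in *; set (A := (RtoC (q m ^ 2) - _)%C).
  assert (EA : (A + delta m * Cconj (delta m) = RtoC (q m ^ 2))%C).
  { unfold A; rewrite Cmod_sq_conj; ring. }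
  destruct (Z.ltb_spec 0 k), (Z.ltb_spec 0 (- k)); try lia.
  - rewrite <- (mobius_adjugate A (delta m) (- Cconj (delta m)) 1 p) at 2.
    + do 2 f_equal; ring.
    + rewrite <- EA in Hq2. intros F; apply Hq2; rewrite <- F; ring.
  - rewrite <- (mobius_adjugate 1 (- delta m) (Cconj (delta m)) A p) at 2.
    + do 2 f_equal; ring.
    + rewrite <- EA in Hq2. intros F; apply Hq2; rewrite <- F; ring.
Qed.

(** [theta m] is the reflection in the unit circle followed by the reflection
    in C_m.  The first exchanges the disks of index m and -m, the second
    exchanges the two sides of C_m; hence the change of sign.  The algebra
    behind it is x' - delta y' = q^2 x for the image (x', y') of (x, y). *)
Lemma side_theta M delta q k p : circular_holes M delta q -> is_index M k ->
  exists r, 0 < r /\ side delta q k (theta delta q k p) = - r * side delta q (- k) p.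
Proof.
  intros (Hq & _) Hk. destruct (index_cases M k Hk) as (Sk & Mk).
  set (m := Z.abs_nat k) in *.
  assert (Hq2 : 0 < q m ^ 2) by (apply pow_lt; auto).
  assert (Hq2C : RtoC (q m ^ 2) <> 0%C) by (apply RtoC_neq_0; lra).
  assert (Em : Z.abs_nat (- k) = m) by (unfold m; lia).
  assert (Hr : forall n : C, n <> 0%C -> 0 < Cmod n ^ 2 * q m ^ 2).
  { intros n Hn; apply Rmult_lt_0_compat; auto. apply pow_lt, Cmod_gt_0; auto. }
  assert (Habs : Cmod (RtoC (q m ^ 2)) = q m ^ 2) by (rewrite Cmod_R, Rabs_pos_eq; lra).
  destruct (Z.lt_total 0 k) as [H|[H|H]]; [|lia|].
  - rewrite side_pos, side_neg by lia. rewrite Em; fold m.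
    unfold theta; destruct (Z.ltb_spec 0 k); [|lia]; fold m.
    unfold theta_pos; set (A := (RtoC (q m ^ 2) - _)%C).
    assert (EA : (A = RtoC (q m ^ 2) - delta m * Cconj (delta m))%C).
    { unfold A; rewrite Cmod_sq_conj; ring. }
    destruct (mobius_coords A (delta m) (- Cconj (delta m)) 1) as (nu & Hnu).
    { intros F; apply Hq2C; rewrite <- F, EA; ring. }
    destruct (Hnu p) as (Hn & -> & ->).
    exists (Cmod (nu p) ^ 2 * q m ^ 2); split; auto.
    rewrite disk_form_scale. unfold disk_form.
    replace (A * hX p + delta m * hY p - delta m * (- Cconj (delta m) * hX p + 1 * hY p))%C
      with (RtoC (q m ^ 2) * hX p)%C by (rewrite EA; ring).
    replace (- Cconj (delta m) * hX p + 1 * hY p)%C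
      with (Cconj (Cconj (hY p) - delta m * Cconj (hX p)))%C
      by (rewrite Cminus_conj, Cmult_conj, !Cconj_conj; ring).
    rewrite Cmod_mult, !Cmod_conj, Habs. ring.
  - rewrite (side_neg _ _ k), side_pos by lia. rewrite Em; fold m.
    unfold theta; destruct (Z.ltb_spec 0 k); [lia|]; fold m.
    unfold theta_neg; set (A := (RtoC (q m ^ 2) - _)%C).
    assert (EA : (A = RtoC (q m ^ 2) - delta m * Cconj (delta m))%C).
    { unfold A; rewrite Cmod_sq_conj; ring. }
    destruct (mobius_coords 1 (- delta m) (Cconj (delta m)) A) as (nu & Hnu).
    { intros F; apply Hq2C; rewrite <- F, EA; ring. }
    destruct (Hnu p) as (Hn & -> & ->).
    exists (Cmod (nu p) ^ 2 * q m ^ 2); split; auto.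
    rewrite !(Cmult_conj (nu p)), disk_form_scale. unfold disk_form.
    rewrite Cmod_conj.
    replace (Cconj (Cconj (delta m) * hX p + A * hY p) -
       delta m * Cconj (1 * hX p + - delta m * hY p))%C
      with (Cconj (RtoC (q m ^ 2) * hY p))%C.
    2:{ rewrite <- (Cconj_conj (delta m)) at 2.
        rewrite <- Cmult_conj, <- Cminus_conj; f_equal; rewrite EA; ring. }
    rewrite !Cmod_conj, Cmod_mult, Habs.
    replace (1 * hX p + - delta m * hY p)%C with (hX p - delta m * hY p)%C by ring. ring.
Qed.

Lemma disk_form_nonpos delta r (x y : C) : 0 < r -> ~ (x = 0%C /\ y = 0%C) ->
  disk_form delta r x y <= 0 -> y <> 0%C /\ Cmod (x / y - delta) <= r.
Proof.
  unfold disk_form; intros Hr Hxy H.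
  destruct (Ceq_dec y 0) as [E|E].
  - exfalso; apply Hxy; split; auto. apply Cmod_eq_0.
    rewrite E, Cmod_0 in H. replace (x - delta * 0)%C with x in H by ring.
    pose proof (Cmod_ge_0 x). nra.
  - split; auto.
    pose proof (proj1 (Cmod_gt_0 y) E) as Hy.
    replace (x / y - delta)%C with ((x - delta * y) / y)%C by (field; auto).
    rewrite Cmod_div by auto. apply (Rmult_le_reg_r (Cmod y)); auto.
    unfold Rdiv; rewrite Rmult_assoc, Rinv_l, Rmult_1_r by lra.
    pose proof (Cmod_ge_0 (x - delta * y)).
    assert (0 <= r * Cmod y) by nra. nra.
Qed.

Lemma side_nonpos M delta q k p : circular_holes M delta q -> is_index M k ->
  side delta q k p <= 0 ->
  exists z, in_closed_disk delta q (Z.abs_nat k) z /\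
    if (0 <? k)%Z then hY p <> 0%C /\ z = (hX p / hY p)%C
    else hX p <> 0%C /\ z = (Cconj (hY p / hX p))%C.
Proof.
  intros (Hq & _) Hk H. destruct (index_cases M k Hk) as (Hs & Hm).
  unfold side in H. destruct (0 <? k)%Z.
  - apply disk_form_nonpos in H; [|auto|apply lift_neq_0].
    destruct H; eexists; split; [|split; [auto|reflexivity]]; auto.
  - apply disk_form_nonpos in H; [|auto|].
    + destruct H as [H1 H2].
      assert (Hx : hX p <> 0%C).
      { intros F; apply H1; rewrite F; apply injective_projections; simpl; ring. }
      eexists; split; [|split; [auto|reflexivity]].
      unfold in_closed_disk. rewrite Cdiv_conj; auto.
    + intros [F1 F2]. apply (lift_neq_0 p); split.
      * destruct (Ceq_dec (hX p) 0) as [E|E]; auto. apply Cconj_neq_0 in E; contradiction.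
      * destruct (Ceq_dec (hY p) 0) as [E|E]; auto. apply Cconj_neq_0 in E; contradiction.
Qed.

Lemma Cmod_quotient_lt_1 (x y : C) : y <> 0%C -> Cmod (x / y) < 1 -> Cmod x < Cmod y.
Proof.
  intros Hy H. rewrite Cmod_div in H by auto. pose proof (proj1 (Cmod_gt_0 y) Hy).
  apply (Rmult_lt_compat_r (Cmod y)) in H; auto.
  unfold Rdiv in H; rewrite Rmult_assoc, Rinv_l in H; lra.
Qed.

(** Two disks of the same sign are disjoint by hypothesis, directly or after
    reflection; disks of opposite sign are separated by the unit circle. *)
Lemma sides_disjoint M delta q i k p : circular_holes M delta q ->
  is_index M i -> is_index M k -> i <> k ->
  side delta q i p <= 0 -> side delta q k p <= 0 -> False.
Proof.
  intros HD Hi Hk Hne H1 H2. pose proof HD as (_ & Hdisj & Hin).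
  apply (side_nonpos M) in H1; auto. apply (side_nonpos M) in H2; auto.
  destruct (index_cases M i Hi) as (Si & Mi), (index_cases M k Hk) as (Sk & Mk).
  destruct H1 as (z1 & D1 & E1), H2 as (z2 & D2 & E2).
  pose proof (Hin _ Mi _ D1) as L1; pose proof (Hin _ Mk _ D2) as L2.
  destruct (Z.ltb_spec 0 i), (Z.ltb_spec 0 k);
    destruct E1 as [N1 E1], E2 as [N2 E2]; rewrite E1 in *; rewrite E2 in *.
  - apply (Hdisj _ _ Mi Mk) with (2 := conj D1 D2). lia.
  - rewrite Cmod_conj in L2.
    apply Cmod_quotient_lt_1 in L1; auto. apply Cmod_quotient_lt_1 in L2; auto. lra.
  - rewrite Cmod_conj in L1.
    apply Cmod_quotient_lt_1 in L1; auto. apply Cmod_quotient_lt_1 in L2; auto. lra.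
  - apply (Hdisj _ _ Mi Mk) with (2 := conj D1 D2). lia.
Qed.

Lemma domain_side M delta q x k : circular_holes M delta q -> in_domain M delta q x ->
  is_index M k -> 0 < side delta q k (Pt x).
Proof.
  intros HD (Hx & Hout) Hk. apply Rnot_le_lt; intros H.
  pose proof HD as (_ & _ & Hin).
  apply (side_nonpos M) in H; auto. destruct (index_cases M k Hk) as (_ & Mk).
  destruct H as (z & D & E). destruct (0 <? k)%Z; destruct E as [N E]; simpl in *.
  - apply (Hout _ Mk). replace x with z; auto. rewrite E; field.
  - pose proof (Hin _ Mk _ D) as L. rewrite E, Cmod_conj in L.
    apply Cmod_quotient_lt_1 in L; auto. rewrite Cmod_1 in L; lra.
Qed.

Lemma theta_into_side M delta q k p : circular_holes M delta q -> is_index M k ->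
  0 < side delta q (- k) p -> side delta q k (theta delta q k p) < 0.
Proof.
  intros HD Hk H. destruct (side_theta M delta q k p HD Hk) as (r & Hr & ->). nra.
Qed.

(** Ping-pong: the image under the tail of the word lies in the disk of the
    next letter, which is not -j, so it is outside the disk of index -j and the
    letter j sends it into the disk of index j. *)
Lemma word_side M delta q x w j : circular_holes M delta q -> in_domain M delta q x ->
  reduced_word M w -> hd_error w = Some j ->
  side delta q j (word_map delta q w (Pt x)) < 0.
Proof.
  intros HD Hx. revert j. induction w as [|i w IH]; intros j (Hall & Hsort) Hj; [discriminate|].
  injection Hj as ->. inversion Hall as [|? ? Hi Hw]; subst.
  apply Sorted_inv in Hsort; destruct Hsort as [Hs Hhd].
  change (side delta q j (theta delta q j (word_map delta q w (Pt x))) < 0).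
  apply (theta_into_side M); auto.
  pose proof (index_opp M j Hi) as Hj'.
  destruct w as [|i w]; [apply (domain_side M); auto|].
  apply Rnot_le_lt; intros H.
  apply (sides_disjoint M delta q (- j) i (word_map delta q (i :: w) (Pt x))); auto.
  - inversion Hw; auto.
  - inversion Hhd; lia.
  - left; apply IH; [split|]; auto.
Qed.

Lemma on_circle_side M delta q k p : circular_holes M delta q -> is_index M k ->
  on_circle delta q k p <-> side delta q k p = 0.
Proof.
  intros HD Hk. destruct (index_cases M k Hk) as (Sk & Mk).
  pose proof HD as (Hq & _). pose proof (Hq _ Mk) as Hqm.
  assert (P : forall r, on_circle_pos delta q (Z.abs_nat k) r <->
     disk_form (delta (Z.abs_nat k)) (q (Z.abs_nat k)) (hX r) (hY r) = 0).
  { set (m := Z.abs_nat k) in *.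
    intros r; unfold on_circle_pos, disk_form; destruct r as [z|]; simpl hX; simpl hY.
    - replace (z - delta m * 1)%C with (z - delta m)%C by ring. rewrite Cmod_1.
      pose proof (Cmod_ge_0 (z - delta m)). split.
      + intros (z' & E & H'). injection E as <-. rewrite H'; ring.
      + intros E. exists z; split; auto. nra.
    - rewrite Cmod_0. replace (1 - delta m * 0)%C with (RtoC 1) by ring. rewrite Cmod_1.
      split; [intros (z & E & _); discriminate | intros; lra]. }
  destruct Sk as [Sk|Sk].
  - unfold on_circle; destruct (Z.ltb_spec 0 k); [|lia]. rewrite P, side_pos by auto. tauto.
  - unfold on_circle; destruct (Z.ltb_spec 0 k); [lia|].
    assert (F : forall r, on_circle_pos delta q (Z.abs_nat k) r <-> side delta q (- k) r = 0).
    { intros r; rewrite P, side_pos by lia. replace (Z.abs_nat (- k))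
        with (Z.abs_nat k) by lia. tauto. }
    split.
    + intros (r & Hr & ->). apply F in Hr.
      destruct (side_theta M delta q k r HD Hk) as (l & Hl & ->). rewrite Hr; ring.
    + intros Hp. exists (theta delta q (- k) p); split; [apply F|].
      * destruct (side_theta M delta q (- k) p HD (index_opp M k Hk)) as (l & Hl & ->).
        rewrite Z.opp_involutive, Hp; ring.
      * symmetry; apply (theta_cancel M); auto.
Qed.

(** Each disk is the Möbius image of the unit disk, under u |-> delta + q u or
    u |-> 1 / (conj delta + q u); this carries the maximum principle over to
    disks, exteriors of circles and half planes alike. *)
Lemma side_parametrization M delta q k : circular_holes M delta q -> is_index M k ->
  exists a b c d : C, (a * d - b * c <> 0)%C /\
    (forall u, exists r, 0 < r /\
       side delta q k (mobius a b c d (Pt u)) = r * (Cmod u ^ 2 - 1)) /\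
    (forall p, side delta q k p <= 0 -> exists u, p = mobius a b c d (Pt u)).
Proof.
  intros HD Hk. destruct (index_cases M k Hk) as (Sk & Mk).
  pose proof HD as (Hq & _). pose proof (Hq _ Mk) as Hqm.
  set (m := Z.abs_nat k) in *.
  assert (HqC : RtoC (q m) <> 0%C) by (apply RtoC_neq_0; lra).
  assert (Hr : forall n : C, n <> 0%C -> 0 < Cmod n ^ 2 * q m ^ 2).
  { intros n Hn; apply Rmult_lt_0_compat; apply pow_lt; auto. apply Cmod_gt_0; auto. }
  assert (Habs : Cmod (q m) = q m) by (rewrite Cmod_R, Rabs_pos_eq; lra).
  destruct Sk as [Sk|Sk].
  - assert (Hdet : (q m * 1 - delta m * 0 <> 0)%C).
    { intros F; apply HqC; rewrite <- F; ring. }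
    exists (RtoC (q m)), (delta m), 0%C, 1%C; split; [exact Hdet|split].
    + intros u. destruct (mobius_coords _ _ _ _ Hdet) as (nu & Hnu).
      destruct (Hnu (Pt u)) as (Hn & E1 & E2).
      exists (Cmod (nu (Pt u)) ^ 2 * q m ^ 2); split; auto.
      rewrite side_pos, E1, E2, disk_form_scale by auto. fold m.
          unfold disk_form; simpl hX; simpl hY.
      replace (0 * u + 1 * 1)%C with (RtoC 1) by ring.
      replace (q m * u + delta m * 1 - delta m * 1)%C with (q m * u)%C by ring.
      rewrite Cmod_1, Cmod_mult, Habs. ring.
    + intros p Hp. apply (side_nonpos M) in Hp; auto. destruct Hp as (z & _ & E).
      destruct (Z.ltb_spec 0 k); [|lia]. destruct E as [N E].
      exists ((z - delta m) / q m)%C. symmetry; apply mobius_char; auto.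
      simpl hX; simpl hY; rewrite E; field; auto.
  - assert (Hdet : (0 * Cconj (delta m) - 1 * q m <> 0)%C).
    { intros F; apply HqC. transitivity (- (0 * Cconj (delta m) - 1 * q m))%C;
        [ring|rewrite F; ring]. }
    exists 0%C, 1%C, (RtoC (q m)), (Cconj (delta m)); split; [exact Hdet|split].
    + intros u. destruct (mobius_coords _ _ _ _ Hdet) as (nu & Hnu).
      destruct (Hnu (Pt u)) as (Hn & E1 & E2).
      exists (Cmod (nu (Pt u)) ^ 2 * q m ^ 2); split; auto.
      rewrite side_neg, E1, E2, !(Cmult_conj (nu _)), disk_form_scale by auto. fold m.
      unfold disk_form; simpl hX; simpl hY. rewrite Cmod_conj.
      replace (0 * u + 1 * 1)%C with (RtoC 1) by ring.
      replace (Cconj (q m * u + Cconj (delta m) * 1) - delta m * Cconj 1)%C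
        with (Cconj (q m * u))%C.
      2:{ rewrite <- (Cconj_conj (delta m)) at 2.
          rewrite <- Cmult_conj, <- Cminus_conj; f_equal; ring. }
      rewrite !Cmod_conj, Cmod_1, Cmod_mult, Habs. ring.
    + intros p Hp. apply (side_nonpos M) in Hp; auto. destruct Hp as (z & _ & E).
      destruct (Z.ltb_spec 0 k); [lia|]. destruct E as [N _].
      exists ((hY p / hX p - Cconj (delta m)) / q m)%C. symmetry; apply mobius_char; auto.
      simpl hX; simpl hY; field; auto.
Qed.

(** The maximum principle on the disk of index [k] for the Möbius function with
    zero [y] and pole [x].  Exchanging [x] and [y] gives the minimum principle. *)
Lemma sdiff_ratio_max M delta q k x y : circular_holes M delta q -> is_index M k ->
  0 < side delta q k x -> 0 < side delta q k y ->
  exists w, side delta q k w = 0 /\ forall p, side delta q k p <= 0 ->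
    Cmod (sdiff y p) / Cmod (sdiff x p) <= Cmod (sdiff y w) / Cmod (sdiff x w).
Proof.
  intros HD Hk Hx Hy.
  destruct (side_parametrization M delta q k HD Hk) as (a & b & c & d & Hdet & Hin & Hsurj).
  destruct (mobius_coords _ _ _ _ Hdet) as (nu & Hnu). unfold multiplier in Hnu.
  set (T := mobius a b c d) in *.
  assert (E : forall s u, sdiff s (T (Pt u)) =
    (nu (Pt u) * ((c * hX s - a * hY s) * u + (d * hX s - b * hY s)))%C).
  { intros s u. destruct (Hnu (Pt u)) as (_ & E1 & E2).
    rewrite sdiff_lift, E1, E2; simpl hX; simpl hY; ring. }
  assert (Hv : (forall u, Cmod u <= 1 ->
     (c * hX x - a * hY x) * u + (d * hX x - b * hY x) <> 0)%C).
  { intros u Hu F. destruct (Hin u) as (r & Hr & Er).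
    assert (x = T (Pt u)) as E'. { apply sdiff_eq0; rewrite E, F; ring. }
    rewrite E', Er in Hx. pose proof (Cmod_ge_0 u). assert (Cmod u ^ 2 <= 1) by nra. nra. }
  pose proof (nonvanishing_on_disk _ _ Hv) as Hlt.
  destruct (mobius_disk_max (c * hX y - a * hY y) (d * hX y - b * hY y) _ _ Hlt)
    as (u0 & Hu0 & Hmax).
  assert (Eq : forall u, Cmod u <= 1 -> Cmod (sdiff y (T (Pt u))) / Cmod (sdiff x (T (Pt u))) =
     Cmod ((c * hX y - a * hY y) * u + (d * hX y - b * hY y)) /
     Cmod ((c * hX x - a * hY x) * u + (d * hX x - b * hY x))).
  { intros u Hu. rewrite !E, !Cmod_mult. destruct (Hnu (Pt u)) as (Hn & _).
    field. split; apply Rgt_not_eq, Cmod_gt_0; auto. }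
  exists (T (Pt u0)); split.
  - destruct (Hin u0) as (r & _ & ->). rewrite Hu0; ring.
  - intros p Hp. destruct (Hsurj p Hp) as (u & ->).
    destruct (Hin u) as (r & Hr & Er).
    assert (Cmod u <= 1).
    { rewrite Er in Hp. apply Rnot_lt_le; intros H.
      assert (1 < Cmod u ^ 2) by nra.
      assert (0 < r * (Cmod u ^ 2 - 1)) by (apply Rmult_lt_0_compat; lra). lra. }
    rewrite !Eq by (auto; lra). auto.
Qed.

(** * Extrema of the cross-ratio on a circle *)

Lemma sdiff_neq_0 p r : p <> r -> 0 < Cmod (sdiff p r).
Proof. intros H; apply Cmod_gt_0; intros F; apply H, sdiff_eq0, F. Qed.

Lemma Cmod_sdiff_sym p r : Cmod (sdiff p r) = Cmod (sdiff r p).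
Proof. rewrite <- Cmod_opp, !sdiff_lift; f_equal; ring. Qed.

Lemma side_neq delta q k p r : side delta q k p <= 0 -> 0 < side delta q k r -> p <> r.
Proof. intros H1 H2 ->; lra. Qed.

(** A point of the domain is outside D_k, but [theta k] sends it into D_k. *)
Lemma fixpoint_not_in_domain M delta q k zfix x : circular_holes M delta q ->
  is_index M k -> theta delta q k zfix = zfix -> in_domain M delta q x -> zfix <> Pt x.
Proof.
  intros HD Hk Hfix Hx ->.
  pose proof (domain_side M delta q x k HD Hx Hk).
  pose proof (theta_into_side M delta q k (Pt x) HD Hk
    (domain_side M delta q x (- k) HD Hx (index_opp M k Hk))).
  rewrite Hfix in H0; lra.
Qed.

Lemma Cmod_cross_ratio a b c d : c <> b -> d <> a ->
  Cmod (cross_ratio a b c d) =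
  Cmod (sdiff d b) / Cmod (sdiff c b) * (Cmod (sdiff c a) / Cmod (sdiff d a)).
Proof.
  intros H1 H2. apply sdiff_neq_0 in H1, H2. unfold cross_ratio.
  rewrite Cmod_div by (apply Cmult_neq_0; apply Cmod_gt_0; auto).
  rewrite !Cmod_mult. field; lra.
Qed.

Lemma ln_le_mono x y : 0 < x -> x <= y -> ln x <= ln y.
Proof. intros H [L| ->]; [left; apply ln_increasing; auto|right; auto]. Qed.

(** The extremal points on the circle are extremal on the whole closed disk, which
    contains the images of zeta and alpha under psi. *)
Lemma R_k_extrema M delta q j k zfix x : circular_holes M delta q ->
  is_index M j -> is_index M k -> k <> (- j)%Z -> theta delta q k zfix = zfix ->
  in_domain M delta q x ->
  exists m1 m2,
    is_min (on_circle delta q j) (fun w => ln (Cmod (R_k delta q k zfix w x))) m1 /\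
    is_max (on_circle delta q j) (fun w => ln (Cmod (R_k delta q k zfix w x))) m2 /\
    forall p, side delta q j p <= 0 ->
      m1 <= ln (Cmod (R_k delta q k zfix p x)) <= m2.
Proof.
  intros HD Hj Hk Hkj Hfix Hx.
  set (y := theta delta q (- k) (Pt x)).
  assert (Hyx : theta delta q k y = Pt x) by (apply (theta_cancel M); auto).
  pose proof (fixpoint_not_in_domain M delta q k zfix x HD Hk Hfix Hx) as Hzx.
  assert (Hzy : y <> zfix) by (intros E; apply Hzx; rewrite <- Hyx, E; auto).
  pose proof (domain_side M delta q x j HD Hx Hj) as Sx.
  (* The zero y of the cross-ratio lies in D_{-k}, which misses D_j. *)
  assert (Sy : 0 < side delta q j y).
  { apply Rnot_le_lt; intros H.
    apply (sides_disjoint M delta q j (- k) y); auto; [apply index_opp; auto|lia|].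
    left; apply (theta_into_side M); auto; [apply index_opp; auto|].
    rewrite Z.opp_involutive. apply (domain_side M); auto. }
  set (K := Cmod (sdiff (Pt x) zfix) / Cmod (sdiff y zfix)).
  assert (HK : 0 < K).
  { apply Rdiv_lt_0_compat; apply sdiff_neq_0; auto. }
  assert (Hpos : forall p, side delta q j p <= 0 ->
     0 < Cmod (sdiff y p) /\ 0 < Cmod (sdiff (Pt x) p)).
  { intros p Hp; split; apply sdiff_neq_0; apply not_eq_sym, (side_neq delta q j); auto. }
  assert (HR : forall p, side delta q j p <= 0 -> Cmod (R_k delta q k zfix p x) =
     K * (Cmod (sdiff y p) / Cmod (sdiff (Pt x) p))).
  { intros p Hp. unfold R_k. fold y. apply Cmod_cross_ratio; auto.
    apply not_eq_sym, (side_neq delta q j); auto. }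
  assert (Hratio : forall p, side delta q j p <= 0 ->
     0 < Cmod (sdiff y p) / Cmod (sdiff (Pt x) p)).
  { intros p Hp; destruct (Hpos p Hp); apply Rdiv_lt_0_compat; auto. }
  destruct (sdiff_ratio_max M delta q j (Pt x) y HD Hj Sx Sy) as (w2 & Z2 & Max).
  destruct (sdiff_ratio_max M delta q j y (Pt x) HD Hj Sy Sx) as (w1 & Z1 & Min).
  assert (B : forall p, side delta q j p <= 0 ->
    ln (Cmod (R_k delta q k zfix w1 x)) <= ln (Cmod (R_k delta q k zfix p x))
      <= ln (Cmod (R_k delta q k zfix w2 x))).
  { intros p Hp. assert (Hw1 : side delta q j w1 <= 0) by lra.
    assert (Hw2 : side delta q j w2 <= 0) by lra.
    pose proof (Hratio p Hp). pose proof (Hratio w1 Hw1).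
    split; apply ln_le_mono; rewrite !HR by auto;
      try (apply Rmult_lt_0_compat; auto); (apply Rmult_le_compat_l; [lra|]); auto.
    specialize (Min p Hp). destruct (Hpos p Hp), (Hpos w1 Hw1).
    rewrite <- (Rinv_div (Cmod (sdiff (Pt x) p))), <- (Rinv_div (Cmod (sdiff (Pt x) w1))).
    apply Rinv_le_contravar; auto. apply Rdiv_lt_0_compat; auto. }
  assert (Bc : forall w, on_circle delta q j w -> side delta q j w <= 0).
  { intros w Hw; apply (on_circle_side M) in Hw; auto; lra. }
  exists (ln (Cmod (R_k delta q k zfix w1 x))), (ln (Cmod (R_k delta q k zfix w2 x))).
  split; [|split]; auto; split.
  - exists w1; split; auto. apply (on_circle_side M); auto.
  - intros w Hw; apply B, Bc, Hw.
  - exists w2; split; auto. apply (on_circle_side M); auto.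
  - intros w Hw; apply B, Bc, Hw.
Qed.

(** * The increment of the potential *)

(** The three-term relation between products of differences of four points:
    (A - alpha)(B - zeta) - (A - zeta)(B - alpha) = (A - B)(alpha - zeta). *)
Lemma R_pot_minus_1 zeta alpha f :
  f (Pt zeta) <> Pt zeta -> f (Pt alpha) <> Pt alpha ->
  (R_pot zeta alpha f - 1)%C =
  (sdiff (f (Pt zeta)) (f (Pt alpha)) * (alpha - zeta) /
   (sdiff (f (Pt zeta)) (Pt zeta) * sdiff (f (Pt alpha)) (Pt alpha)))%C.
Proof.
  intros H1 H2. apply sdiff_neq_0, Cmod_gt_0 in H1, H2. unfold R_pot.
  rewrite !sdiff_lift in *. simpl hX in *; simpl hY in *.
  rewrite Cmult_1_r in H1, H2. field. auto.
Qed.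

Lemma U_pot_expand zeta alpha f : zeta <> alpha ->
  f (Pt zeta) <> Pt zeta -> f (Pt alpha) <> Pt alpha -> f (Pt zeta) <> f (Pt alpha) ->
  U_pot zeta alpha f =
  ln (Cmod (sdiff (f (Pt zeta)) (Pt zeta))) + ln (Cmod (sdiff (f (Pt alpha)) (Pt alpha)))
  - ln (Cmod (sdiff (f (Pt zeta)) (f (Pt alpha)))) - ln (Cmod (alpha - zeta)).
Proof.
  intros Hne H1 H2 H12. unfold U_pot. rewrite R_pot_minus_1 by auto.
  apply sdiff_neq_0 in H1, H2, H12.
  assert (H0 : 0 < Cmod (alpha - zeta)).
  { apply (sdiff_neq_0 (Pt alpha) (Pt zeta)). congruence. }
  rewrite Cmod_div, !Cmod_mult by (apply Cmult_neq_0; apply Cmod_gt_0; auto).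
  rewrite ln_div, !ln_mult by (auto; apply Rmult_lt_0_compat; auto). ring.
Qed.

(** Comparing differences before and after T gives x - z = nu(y) nu(z) det (y - z)
    and T w - x = nu(w) nu(y) det (w - y); in the cross-ratio nu(y) and det
    cancel. *)
Lemma ln_cross_ratio_mobius (a b c d : C) nu w z y x :
  (a * d - b * c <> 0)%C -> multiplier a b c d nu ->
  mobius a b c d z = z -> mobius a b c d y = x -> z <> x -> w <> x ->
  mobius a b c d w <> x ->
  ln (Cmod (cross_ratio w z y x)) =
  ln (Cmod (nu z)) - ln (Cmod (nu w))
  + ln (Cmod (sdiff (mobius a b c d w) x)) - ln (Cmod (sdiff w x)).
Proof.
  intros Hdet Hnu Hz Hy Hzx Hwx HTw.
  assert (Hyz : y <> z) by congruence.
  assert (Hyw : w <> y) by congruence.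
  pose proof (sdiff_mobius a b c d nu y z Hnu) as E1. rewrite Hy, Hz in E1.
  pose proof (sdiff_mobius a b c d nu w y Hnu) as E2. rewrite Hy in E2.
  rewrite Cmod_cross_ratio by auto. rewrite E1, E2.
  rewrite (Cmod_sdiff_sym y w), (Cmod_sdiff_sym x w), !Cmod_mult.
  apply sdiff_neq_0 in Hyz, Hyw, Hwx.
  apply Cmod_gt_0 in Hdet.
  destruct (Hnu w) as (N1 & _), (Hnu y) as (N2 & _), (Hnu z) as (N3 & _).
  apply Cmod_gt_0 in N1, N2, N3.
  rewrite ln_mult, !ln_div, !ln_mult; repeat first
    [assumption | apply Rmult_lt_0_compat | apply Rinv_0_lt_compat]. ring.
Qed.

(** The exact formula behind the bounds: psi enters the right-hand side only
    through the two points psi(zeta) and psi(alpha). *)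
Lemma U_pot_increment (a b c d : C) nu z yz ya zeta alpha psi :
  let T := mobius a b c d in
  (a * d - b * c <> 0)%C -> multiplier a b c d nu ->
  T z = z -> T yz = Pt zeta -> T ya = Pt alpha ->
  z <> Pt zeta -> z <> Pt alpha -> zeta <> alpha ->
  psi (Pt zeta) <> Pt zeta -> psi (Pt alpha) <> Pt alpha ->
  psi (Pt zeta) <> psi (Pt alpha) ->
  T (psi (Pt zeta)) <> Pt zeta -> T (psi (Pt alpha)) <> Pt alpha ->
  U_pot zeta alpha (fun p => T (psi p)) - U_pot zeta alpha psi =
  - ln (Cmod (nu z * nu z * (a * d - b * c)))
  + ln (Cmod (cross_ratio (psi (Pt zeta)) z yz (Pt zeta)))
  + ln (Cmod (cross_ratio (psi (Pt alpha)) z ya (Pt alpha))).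
Proof.
  intros T Hdet Hnu Hz Hyz Hya Hzz Hza Hne P1 P2 P12 T1 T2.
  set (A := psi (Pt zeta)) in *; set (B := psi (Pt alpha)) in *.
  assert (E : sdiff (T A) (T B) = (nu A * nu B * (a * d - b * c) * sdiff A B)%C)
    by (apply sdiff_mobius; auto).
  pose proof (proj1 (Cmod_gt_0 _) Hdet) as Ldet. pose proof (sdiff_neq_0 _ _ P12) as L12.
  destruct (Hnu A) as (N1 & _), (Hnu B) as (N2 & _), (Hnu z) as (N3 & _).
  assert (T12 : T A <> T B).
  { intros F. assert (F' : sdiff (T A) (T B) = 0%C) by (rewrite F, sdiff_lift; ring).
    apply (proj2 (Cmod_gt_0 (sdiff (T A) (T B)))) in F'; auto.
    rewrite E. apply Cmod_gt_0. repeat apply Cmult_neq_0; auto. apply Cmod_gt_0; auto. }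
  rewrite !U_pot_expand by auto. fold A B.
  rewrite (ln_cross_ratio_mobius a b c d nu A z yz (Pt zeta)) by auto.
  rewrite (ln_cross_ratio_mobius a b c d nu B z ya (Pt alpha)) by auto.
  fold T. rewrite E, !Cmod_mult.
  apply Cmod_gt_0 in N1, N2, N3.
  rewrite !ln_mult; repeat first [assumption | apply Rmult_lt_0_compat]. ring.
Qed.

(** * The two-sided bound *)

Lemma theta_inj M delta q k p r : circular_holes M delta q -> is_index M k ->
  theta delta q k p = theta delta q k r -> p = r.
Proof.
  intros HD Hk E. pose proof (index_opp M k Hk) as Hk'.
  rewrite <- (theta_cancel M delta q (- k) p HD Hk'), <- (theta_cancel M delta q (- k) r HD Hk').
  rewrite Z.opp_involutive, E; auto.
Qed.

Lemma word_map_inj M delta q w p r : circular_holes M delta q -> List.Forall (is_index M) w ->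
  word_map delta q w p = word_map delta q w r -> p = r.
Proof.
  intros HD; revert p r; induction w as [|i w IH]; intros p r Hw E; auto.
  inversion Hw; subst. apply IH; auto. apply (theta_inj M delta q i); auto.
Qed.

Lemma word_image_neq M delta q x w : circular_holes M delta q -> in_domain M delta q x ->
  reduced_word M w -> w <> nil -> word_map delta q w (Pt x) <> Pt x.
Proof.
  intros HD Hx Hw Hnil. destruct w as [|i w]; [congruence|].
  apply (side_neq delta q i).
  - left; apply (word_side M); auto.
  - apply (domain_side M); auto. destruct Hw as (Hall & _); inversion Hall; auto.
Qed.

Theorem theorem5p1 (M : nat) (delta : nat -> C) (q : nat -> R)
  (zeta alpha : C) (j k : Z) (zfix : sphere)
  (hM : (1 <= M)%nat)
  (hD : circular_holes M delta q)
  (hzeta : in_domain M delta q zeta)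
  (halpha : in_domain M delta q alpha)
  (hne : zeta <> alpha)
  (hj : is_index M j) (hk : is_index M k) (hkj : k <> (- j)%Z)
  (hfix : theta delta q k zfix = zfix) :
  exists lb ub : R,
    is_Delta_lb delta q zeta alpha j k zfix lb /\
    is_Delta_ub delta q zeta alpha j k zfix ub /\
    forall w : list Z, reduced_word M w -> hd_error w = Some j ->
      let psi := word_map delta q w in
      lb <= U_pot zeta alpha (fun p => theta delta q k (psi p))
            - U_pot zeta alpha psi <= ub.
Proof.
  destruct (theta_mobius M delta q k hD hk) as (a & b & c & d & ET & Hdet).
  destruct (mobius_coords a b c d Hdet) as (nu & Hnu).
  destruct (R_k_extrema M delta q j k zfix zeta) as (l1 & u1 & Hl1 & Hu1 & B1); auto.
  destruct (R_k_extrema M delta q j k zfix alpha) as (l2 & u2 & Hl2 & Hu2 & B2); auto.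
  set (lam := (nu zfix * nu zfix * (a * d - b * c))%C).
  assert (Hlam : is_derivative_at_fixpoint (theta delta q k) zfix lam).
  { rewrite ET in *. destruct (Hnu zfix) as (Hn & E1 & E2). rewrite hfix in E1, E2.
    apply mobius_fixpoint_derivative; auto. }
  exists (- ln (Cmod lam) + l1 + l2), (- ln (Cmod lam) + u1 + u2).
  split; [exists lam, l1, l2; auto|split; [exists lam, u1, u2; auto|]].
  intros w Hw Hhd psi.
  assert (Hnil : w <> nil) by (destruct w; discriminate).
  assert (Hkw : reduced_word M (k :: w)).
  { destruct Hw as (Hall & Hsort); split; constructor; auto.
    destruct w as [|i w]; constructor. injection Hhd as ->; auto. }
  assert (E : U_pot zeta alpha (fun p => theta delta q k (psi p)) - U_pot zeta alpha psi
    = - ln (Cmod lam) + ln (Cmod (R_k delta q k zfix (psi (Pt zeta)) zeta))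
      + ln (Cmod (R_k delta q k zfix (psi (Pt alpha)) alpha))).
  { assert (Tz : theta delta q k (psi (Pt zeta)) <> Pt zeta)
      by (apply (word_image_neq M delta q zeta (k :: w)); auto; discriminate).
    assert (Ta : theta delta q k (psi (Pt alpha)) <> Pt alpha)
      by (apply (word_image_neq M delta q alpha (k :: w)); auto; discriminate).
    pose proof (fun x => theta_cancel M delta q k x hD hk) as Hinv.
    pose proof (fixpoint_not_in_domain M delta q k zfix zeta hD hk hfix hzeta).
    pose proof (fixpoint_not_in_domain M delta q k zfix alpha hD hk hfix halpha).
    unfold R_k. set (yz := theta delta q (- k) (Pt zeta)).
    set (ya := theta delta q (- k) (Pt alpha)).
    pose proof (Hinv (Pt zeta) : theta delta q k yz = Pt zeta) as Iz.
    pose proof (Hinv (Pt alpha) : theta delta q k ya = Pt alpha) as Ia.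
    clearbody yz ya. clear Hinv.
    rewrite ET in *. apply U_pot_increment; auto.
    - apply (word_image_neq M); auto.
    - apply (word_image_neq M); auto.
    - intros F. apply (word_map_inj M) in F; auto; [congruence|apply Hw]. }
  rewrite E.
  pose proof (B1 _ (Rlt_le _ _ (word_side M delta q zeta w j hD hzeta Hw Hhd))).
  pose proof (B2 _ (Rlt_le _ _ (word_side M delta q alpha w j hD halpha Hw Hhd))).
  fold psi in H, H0. lra.
Qed.
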